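(* Let $f:(0,\infty)\to\mathbb{R}$ be a strictly convex function with $f(1)=0$. Let $\mu$ and $\nu$ be probability distributions on $\mathbb{R}^d$ and $\mathbb{R}^m$ respectively, and let $\phi:\mathbb{R}^m\to\mathbb{R}^d$ be a ReLU neural network. (a) If $m<d$ and $\mu$ is absolutely continuous with respect to the Lebesgue measure on $\mathbb{R}^d$, then $\mu$ and $\phi_\#\nu$ are mutually singular, and hence $D_f(\mu\,\|\,\phi_\#\nu)$ is the positive constant $f(0)+f^*(0)$. (b) More generally, suppose that $\mu$ is absolutely continuous with respect to the Riemannian measure on some Riemannian manifold $\mathcal{M}$ (in $\mathbb{R}^d$) of dimension $s\le d$. If $m<s$, then $\mu$ and $\phi_\#\nu$ are mutually singular, and hence $$ D_f(\mu\,\|\,\phi_\#\nu)=f(0)+f^*(0)>0 . $$ Therefore, in order to approximate $\mu$ by such push-forwards $\phi_\#\nu$ in $f$-divergence, it is necessary that $m\ge s$.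
   Context: $f(0):=\lim_{t\downarrow0}f(t)$ and $f^*(0):=\lim_{t\to\infty}f(t)/t$. For probability measures $\mu,\gamma$ on $\mathbb{R}^d$ absolutely continuous with respect to a probability measure $\tau$ (one can always take $\tau=(\mu+\gamma)/2$), with $p=d\mu/d\tau$ and $q=d\gamma/d\tau$, the $f$-divergence of $\mu$ from $\gamma$ is $$D_f(\mu\|\gamma):=\int_{\mathbb{R}^d}f\!\left(\frac{p(x)}{q(x)}\right)q(x)\,d\tau(x)=\int_{q>0}f\!\left(\frac{p(x)}{q(x)}\right)q(x)\,d\tau(x)+f^*(0)\,\mu(q=0),$$ with the convention that $f(p(x)/q(x))q(x)=0$ if $p(x)=q(x)=0$ and $f(p(x)/q(x))q(x)=f^*(0)p(x)$ if $q(x)=0$ and $p(x)\ne0$; it does not depend on the choice of $\tau$. A ReLU neural network is a map of the form $\phi=A_L\circ\sigma\circ A_{L-1}\circ\cdots\circ\sigma\circ A_0$ with $L\ge1$, $A_\ell$ affine maps between finite-dimensional Euclidean spaces and $\sigma(x)=\max\{x,0\}$ applied element-wise. The push-forward is $\phi_\#\nu(A)=\nu(\phi^{-1}(A))$. *)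

(* Defs.v *)
From HB Require Import structures.
From mathcomp Require Import all_boot all_order all_algebra.
From mathcomp Require Import all_classical all_reals all_analysis.
From mathcomp Require Import measurable_realfun.

Set Implicit Arguments.
Unset Strict Implicit.
Unset Printing Implicit Defensive.

Import Order.TTheory GRing.Theory Num.Theory.
Import numFieldNormedType.Exports.

Local Open Scope classical_set_scope.
Local Open Scope ring_scope.

(* The Borel sigma-algebra on matrices, hence on R^n, rendered as row vectors. *)
HB.instance Definition _ (R : realType) (m n : nat) :=
  @isMeasurable.Build (sigma_display (@open 'M[R]_(m, n))) 'M[R]_(m, n)
    <<s (@open 'M[R]_(m, n)) >> (@sigma_algebra0 _ setT _) (@sigma_algebraC _ _)
    (@sigma_algebra_bigcup _ setT _).

Section borel_coordinates.
Context {R : realType} {n : nat}.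

Lemma measurable_rV_coord (j : 'I_n) :
  measurable_fun [set: 'rV[R]_n] (fun v => v ord0 j).
Proof.
apply: (measurability _ (RGenOpens.measurableE R)).
move=> _ [_ [a [b ->]] <-].
rewrite setTI; apply: sub_sigma_algebra.
have /continuousP := @coord_continuous R 1 n ord0 j.
by apply; exact: interval_open.
Qed.

Lemma measurable_fun_rV d (T : measurableType d) (f : T -> 'rV[R]_n) :
  (forall j, measurable_fun [set: T] (fun t => f t ord0 j)) ->
  measurable_fun [set: T] f.
Proof.
move=> mf.
apply: (@measurability _ _ _ _ _ _ (@open 'rV[R]_n)) => // _ [D oD <-].
rewrite setTI.
pose box (i : 'rV[rat]_n * nat) : set 'rV[R]_n :=
  [set v | forall j, `|ratr (i.1 ord0 j) - v ord0 j| < i.2.+1%:R^-1].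
pose J := [set i | box i `<=` D].
have -> : f @^-1` D = \bigcup_(i in J) (f @^-1` box i).
  apply/seteqP; split=> [t /= Dt|t [i /= Ji] bt]; last exact: Ji.
  have /nbhs_ballP[e /= e_gt0 eD] : nbhs (f t) D.
    exact: open_nbhs_nbhs (conj oD Dt).
  have [k ke] : exists k : nat, k.+1%:R^-1 < e / 2.
    have e2 : 0 < e / 2 by rewrite divr_gt0.
    have [k _ /(_ k (ssrnat.leqnn k)) kE] := near_infty_natSinv_lt (PosNum e2).
    by exists k; exact: kE.
  have /choice[q qP] j : exists q : rat, `|ratr q - f t ord0 j| < k.+1%:R^-1.
    have k0 : 0 < k.+1%:R^-1 :> R by rewrite invr_gt0.
    have /rat_in_itvoo[q] : f t ord0 j - k.+1%:R^-1 < f t ord0 j + k.+1%:R^-1.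
      by rewrite ltrBlDr -addrA ltrDl addr_gt0.
    by rewrite in_itv/= => qt; exists q; rewrite ltr_distl.
  exists (\row_j q j, k) => /= [v bv|j]; last by rewrite mxE.
  apply: eD; split=> // i j; rewrite ord1 /ball/=.
  rewrite (splitr e) (le_lt_trans (ler_distD (ratr (q j)) _ _))//.
  have := bv j; rewrite mxE/= => bvj.
  by rewrite ltrD// ?(lt_trans _ ke)// distrC.
rewrite bigcup_mkcond; apply: countable_bigcupT_measurable.
  exact: countableP.
move=> i; case: ifPn => // _.
have -> : f @^-1` box i = \bigcap_(j in [set: 'I_n])
    ((fun t => f t ord0 j) @^-1` ball (ratr (i.1 ord0 j) : R) i.2.+1%:R^-1).
  by apply/seteqP; split=> [t bt j _|t bt j]; [exact: bt|exact: (bt j I)].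
apply: fin_bigcap_measurable => [|j _]; first exact: finite_finset.
rewrite -[X in measurable X]setTI; apply: mf => //.
exact: measurable_ball.
Qed.
End borel_coordinates.

Section lebesgue_rV.
Context {R : realType}.

Definition cons_rV n (p : R * 'rV[R]_n) : 'rV[R]_n.+1 :=
  \row_j oapp (fun k => p.2 ord0 k) p.1 (unlift ord0 j).

Lemma measurable_cons_rV n :
  measurable_fun [set: measurableTypeR R * 'rV[R]_n] (@cons_rV n).
Proof.
apply: measurable_fun_rV => j; under eq_fun do rewrite mxE.
case: unliftP => [k _|_] /=; last exact: measurable_fst.
exact: (measurableT_comp (measurable_rV_coord k) measurable_snd).
Qed.

Section step.
Variables (n : nat) (l : {measure set 'rV[R]_n -> \bar R}).

Definition lebesgue_step : set 'rV[R]_n.+1 -> \bar R :=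
  pushforward (@lebesgue_measure R \x^ l)%E (@cons_rV n).

Let step0 : lebesgue_step set0 = 0%E.
Proof. by apply: measure0; exact: measurable_cons_rV. Qed.

Let step_ge0 A : (0 <= lebesgue_step A)%E.
Proof. by apply: measure_ge0; exact: measurable_cons_rV. Qed.

Let step_sigma_additive : semi_sigma_additive lebesgue_step.
Proof. by apply: measure_semi_sigma_additive; exact: measurable_cons_rV. Qed.

HB.instance Definition _ := isMeasure.Build _ _ _ lebesgue_step
  step0 step_ge0 step_sigma_additive.

End step.

(* n-dimensional Lebesgue measure: the n-fold product of the Lebesgue measure
   on R, transported to row vectors. *)
Fixpoint lebesgue_rV (n : nat) : {measure set 'rV[R]_n -> \bar R} :=
  if n is k.+1 then lebesgue_step (lebesgue_rV k)
  else \d_(0 : 'rV[R]_0).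

End lebesgue_rV.

Section relu_networks.
Context {R : realType}.

Definition affine_map m n (A : 'M[R]_(m, n)) (b : 'rV[R]_n) (x : 'rV[R]_m) :=
  x *m A + b.

Definition relu n (x : 'rV[R]_n) : 'rV[R]_n := map_mx (Num.max ^~ 0) x.

(* A_L \o relu \o A_(L-1) \o ... \o relu \o A_0 with L >= 1 *)
Inductive relu_map (m : nat) : forall n, ('rV[R]_m -> 'rV[R]_n) -> Prop :=
| relu_map_base k n (A0 : 'M[R]_(m, k)) b0 (A1 : 'M[R]_(k, n)) b1 :
    relu_map (affine_map A1 b1 \o @relu k \o affine_map A0 b0)
| relu_map_step k n (A : 'M[R]_(k, n)) b (phi : 'rV[R]_m -> 'rV[R]_k) :
    relu_map phi -> relu_map (affine_map A b \o @relu k \o phi).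

Lemma measurable_affine_map m n (A : 'M[R]_(m, n)) b :
  measurable_fun [set: 'rV[R]_m] (affine_map A b).
Proof.
apply: measurable_fun_rV => j; under eq_fun do rewrite !mxE.
apply: measurable_funD => //; apply: measurable_sum => i.
by apply: measurable_funM => //; exact: measurable_rV_coord.
Qed.

Lemma measurable_relu n : measurable_fun [set: 'rV[R]_n] (@relu n).
Proof.
apply: measurable_fun_rV => j; under eq_fun do rewrite !mxE.
by apply: measurable_maxr => //; exact: measurable_rV_coord.
Qed.

Lemma measurable_relu_map m n (phi : 'rV[R]_m -> 'rV[R]_n) :
  relu_map phi -> measurable_fun [set: 'rV[R]_m] phi.
Proof.
have mAr k l (A : 'M[R]_(k, l)) b :
    measurable_fun [set: 'rV[R]_k] (affine_map A b \o @relu k).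
  exact: (measurableT_comp (measurable_affine_map A b) (@measurable_relu k)).
elim=> [k l A0 b0 A1 b1|k l A b psi _ mpsi].
  exact: (measurableT_comp (mAr _ _ A1 b1) (measurable_affine_map A0 b0)).
exact: (measurableT_comp (mAr _ _ A b) mpsi).
Qed.

End relu_networks.

Record relu_network (R : realType) (m d : nat) := ReluNetwork {
  relu_fun :> 'rV[R]_m -> 'rV[R]_d;
  relu_funP : relu_map relu_fun }.

HB.instance Definition _ (R : realType) m d (phi : relu_network R m d) :=
  isMeasurableFun.Build _ _ _ _ (relu_fun phi)
    (measurable_relu_map (relu_funP phi)).

Section divergence.
Context {R : realType}.
Implicit Types (f : R -> R) (p q : R).

(* Only the values of [f] on the open half-line matter, here and below. *)
Definition strictly_convex_pos f := forall x y t, 0 < x -> 0 < y -> x != y ->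
  0 < t < 1 -> f (t * x + (1 - t) * y) < t * f x + (1 - t) * f y.

(* f(0) and f^*(0); both limits may be +oo *)
Definition f_at0 f : \bar R := lim ((f t)%:E @[t --> 0^'+]).
Definition fstar_at0 f : \bar R := lim ((f t / t)%:E @[t --> +oo]).

(* f (p / q) * q under the usual conventions; as +oo * 0 = 0, the case
   p = q = 0 yields 0. *)
Definition fdiv_integrand f p q : \bar R :=
  if q == 0 then (fstar_at0 f * p%:E)%E
  else ((if (p == 0)%R then f_at0 f else (f (p / q))%:E) * q%:E)%E.

Context {d} {T : measurableType d}.
Implicit Types mu gamma : probability T R.
Local Open Scope charge_scope.

Definition midpoint mu gamma : set T -> \bar R :=
  mscale (2^-1)%:nng (measure_add mu gamma).

HB.instance Definition _ mu gamma := Measure.on (midpoint mu gamma).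

Lemma midpointE mu gamma A :
  midpoint mu gamma A = ((2^-1)%:E * (mu A + gamma A))%E.
Proof. by rewrite -(measure_addE mu gamma). Qed.

Let midpoint_setT mu gamma : midpoint mu gamma [set: T] = 1%E.
Proof.
rewrite midpointE !probability_setT -EFinD -EFinM -[1 + 1](@natrD R 1 1).
by rewrite mulVf// pnatr_eq0.
Qed.

HB.instance Definition _ mu gamma :=
  Measure_isProbability.Build _ _ _ (midpoint mu gamma) (midpoint_setT mu gamma).

(* D_f(mu || gamma), computed with respect to tau = (mu + gamma) / 2 *)
Definition fdiv f mu gamma : \bar R :=
  let tau := midpoint mu gamma in
  let p := 'd (charge_of_finite_measure mu) '/d tau in
  let q := 'd (charge_of_finite_measure gamma) '/d tau in
  (\int[tau]_x fdiv_integrand f (fine (p x)) (fine (q x)))%E.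

Definition mutually_singular mu gamma := exists A : set T,
  [/\ measurable A, mu A = 0%E & gamma (~` A) = 0%E].

End divergence.

Section smooth.
Context {R : realType} {V W : normedModType R}.

(* f is of class C^k on the open set U *)
Fixpoint Ck_on (k : nat) (U : set V) (f : V -> W) : Prop :=
  if k is j.+1 then
    (forall x, U x -> differentiable f x) /\ forall v, Ck_on j U ('D_v f)
  else forall x, U x -> {for x, continuous f}.

Definition smooth_on U f := forall k, Ck_on k U f.

End smooth.

Section riemannian.
Context {R : realType} {d : nat}.
Implicit Types (M : set 'rV[R]_d) (g : 'rV[R]_d -> 'M[R]_d).

(* [psi] parametrizes the open subset psi(U) of M; the last condition says that
   psi : U -> M is an open map for the topology that M inherits from R^d. *)
Definition local_parametrization s M (U : set 'rV[R]_s)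
    (psi : 'rV[R]_s -> 'rV[R]_d) :=
  [/\ open U, smooth_on U psi, {in U &, injective psi},
      (forall u, U u -> row_free ('J psi u)) &
      forall U', open U' -> U' `<=` U ->
        exists2 O, open O & psi @` U' = M `&` O].

Definition embedded_submanifold s M := forall x, M x ->
  exists U psi, @local_parametrization s M U psi /\ (psi @` U) x.

(* [g x] is a d x d matrix whose bilinear form is used on the tangent space
   T_x M only; every inner product on T_x M arises in this way.  The Gram matrix
   below collects the coefficients g_ij in the coordinates given by psi
   (differentials act on row vectors). *)
Definition metric_coefs s g (psi : 'rV[R]_s -> 'rV[R]_d) (u : 'rV[R]_s) :
    'M[R]_s :=
  'J psi u *m g (psi u) *m ('J psi u)^T.

Definition riemannian_metric s M g := forall U psi,
  @local_parametrization s M U psi ->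
  smooth_on U (metric_coefs g psi) /\
  forall u, U u -> let G := metric_coefs g psi u in
    G^T = G /\ forall v : 'rV[R]_s, v != 0 -> 0 < (v *m G *m v^T) ord0 ord0.

(* The Riemannian measure of (M, g), as a Borel measure on R^d carried by M:
   it is sqrt(det (g_ij)) du_1 ... du_s in local coordinates. *)
Definition riemannian_measure s M g
    (vol : {measure set 'rV[R]_d -> \bar R}) :=
  vol (~` M) = 0%E /\
  forall U psi, @local_parametrization s M U psi ->
    forall A, measurable A ->
    vol (A `&` psi @` U) =
      (\int[lebesgue_rV s]_(u in U `&` psi @^-1` A)
         (Num.sqrt (\det (metric_coefs g psi u)))%:E)%E.

End riemannian.

(* Main.v *)
Require Import Defs.
From HB Require Import structures.
From mathcomp Require Import all_boot all_order all_algebra.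
From mathcomp Require Import all_classical all_reals all_analysis.
From mathcomp Require Import measurable_realfun ring lra.

Set Implicit Arguments.
Unset Strict Implicit.
Unset Printing Implicit Defensive.

Import Order.TTheory GRing.Theory Num.Theory.
Import numFieldNormedType.Exports.
Local Open Scope classical_set_scope.
Local Open Scope ring_scope.

(* A ReLU network is piecewise affine, so its range lies in finitely many
   affine subspaces of dimension at most m. In a chart psi of an s-dimensional
   manifold, m < s, such a subspace pulls back to a level set psi u *m C = b
   with 'J psi u *m C <> 0 everywhere, so at each of its points some component
   of psi *m C has a nonzero partial derivative along some basis vector e_i.
   The points with a given component and a given i are isolated on every line
   of direction e_i, hence form a Lebesgue-null set by Fubini. Countably many
   charts cover the manifold, so the range of the network is null for its
   volume, and thus for mu, whereas it carries the push-forward of nu. For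
   mutually singular measures, p and q take only the values 0 and 2, which
   gives D_f = f(0) + f^*(0); this is positive because the chord slopes f t /
   (t - 1) tend to -f(0) at 0 and to f^*(0) at infinity. *)

(** * Lebesgue measure on row vectors *)

Lemma cons_rV0 (R : realType) n (x : R) (w : 'rV[R]_n) :
  cons_rV (x, w) ord0 ord0 = x.
Proof. by rewrite mxE unlift_none. Qed.

Lemma cons_rV_lift (R : realType) n (x : R) (w : 'rV[R]_n) k :
  cons_rV (x, w) ord0 (lift ord0 k) = w ord0 k.
Proof. by rewrite mxE liftK. Qed.

(** Uniqueness of product measures rests on sigma-finiteness, and that uniqueness is what permits
    slicing in the other order below. *)
Lemma sigma_finite_lebesgue_rV (R : realType) n :
  sigma_finite [set: 'rV[R]_n] (lebesgue_rV n).
Proof.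
elim: n => [|n /sigma_finiteP[G [TG ndG Goo]]].
  exact: (sigma_finiteT (dirac (0 : 'rV[R]_0) : {finite_measure set _ -> \bar R})).
have /sigma_finiteP[F [TF ndF Foo]] :=
  sigma_finiteT (@lebesgue_measure R : {sigma_finite_measure set _ -> \bar R}).
pose tail (v : 'rV[R]_n.+1) : 'rV[R]_n := \row_k v ord0 (lift ord0 k).
have mtail : measurable_fun [set: 'rV[R]_n.+1] tail.
  apply: measurable_fun_rV => k; under eq_fun do rewrite mxE.
  exact: measurable_rV_coord.
pose B k : set 'rV[R]_n.+1 :=
  [set v : 'rV[R]_n.+1 | F k (v ord0 ord0)] `&` (tail @^-1` G k).
have tail_cons x w : tail (cons_rV (x, w)) = w.
  by apply/rowP => j; rewrite mxE cons_rV_lift.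
have BE k : @cons_rV R n @^-1` B k = F k `*` G k.
  by apply/seteqP; split=> -[x w]; rewrite /B /= cons_rV0 tail_cons.
exists B.
  apply/seteqP; split=> // v _.
  have [i _ Fi] : (\bigcup_i F i) (v ord0 ord0) by rewrite -TF.
  have [j _ Gj] : (\bigcup_i G i) (tail v) by rewrite -TG.
  (* Both exhaustions increase, so the diagonal products of [F k] and [G k] already cover. *)
  exists (maxn i j) => //; split => /=.
    by move: Fi; apply/subsetPset/ndF/leq_maxl.
  by move: Gj; apply/subsetPset/ndG/leq_maxr.
move=> k; have [mF Fk] := Foo k; have [mG Gk] := Goo k; split.
  apply: measurableI.
    rewrite -[X in measurable X]setTI.
    by apply: (measurable_rV_coord ord0).
  by rewrite -[X in measurable X]setTI; exact: mtail.
rewrite /= /lebesgue_step /pushforward BE product_measure2E//.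
by rewrite lte_mul_pinfty// ge0_fin_numE.
Qed.

(** Tonelli for null sets. The second alternative unfolds the product measure behind [lebesgue_rV];
    the first exchanges the order of integration. *)
Lemma lebesgue_rVS_eq0 (R : realType) n (A : set 'rV[R]_n.+1) : measurable A ->
  (forall x : R, lebesgue_rV n [set w | A (cons_rV (x, w))] = 0%E) \/
  (forall w : 'rV[R]_n, @lebesgue_measure R [set x | A (cons_rV (x, w))] = 0%E) ->
  lebesgue_rV n.+1 A = 0%E.
Proof.
move=> mA; rewrite /= /lebesgue_step /pushforward.
set B := @cons_rV R n @^-1` A.
have mB : measurable B.
  by rewrite /B -[X in measurable X]setTI; exact: measurable_cons_rV.
case=> A0; last first.
  rewrite /product_measure2; apply: integral0_eq => w _ /=.
  rewrite -[RHS](A0 w); congr (lebesgue_measure _).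
  by apply/seteqP; split=> x; rewrite /B /ysection /= inE.
(* The measure is destructed so that its function can be repacked together with sigma-finiteness. *)
have := sigma_finite_lebesgue_rV R n; case: (lebesgue_rV n) A0 => l c A0 sfl.
pose l' : {measure set 'rV[R]_n -> \bar R} := Measure.Pack c.
pose L : {sigma_finite_measure set 'rV[R]_n -> \bar R} :=
  HB.pack l c (Measure_isSigmaFinite.Build _ _ _ l' sfl).
rewrite -(@product_measure_unique _ _ _ _ R lebesgue_measure L
  (lebesgue_measure \x^ l')%E)//; last first.
  by move=> X Y mX mY; exact: product_measure2E.
rewrite /product_measure1; apply: integral0_eq => x _ /=.
rewrite -[RHS](A0 x); congr (l _).
by apply/seteqP; split=> w; rewrite /B /xsection /= inE.
Qed.

(** Induction on the dimension. A direction other than the first stays inside the slices with fixed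
    first coordinate, where the induction hypothesis applies; for the first direction the slices are
    the lines themselves, and countable sets are null. *)
Lemma lebesgue_rV_countable_lines (R : realType) n (j : 'I_n)
    (A : set 'rV[R]_n) : measurable A ->
  (forall v, countable [set t : R | A (v + t *: delta_mx ord0 j)]) ->
  lebesgue_rV n A = 0%E.
Proof.
elim: n j A => [[]//|n IH] j A mA cA; apply: lebesgue_rVS_eq0 => //.
case: (unliftP ord0 j) => [k jk|j0]; [left=> x|right=> w].
  apply: (IH k) => [|v].
    have mc : measurable_fun [set: 'rV[R]_n] (fun w => cons_rV (x, w)).
      apply: (measurableT_comp (@measurable_cons_rV R n)).
      exact: (pair1_measurable (x : measurableTypeR R)).
    by have := mc measurableT _ mA; rewrite setTI.
  apply: sub_countable (cA (cons_rV (x, v))); apply: subset_card_le => t /=.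
  congr (A _); apply/rowP => i; case: (unliftP ord0 i) => [i' ->|->].
    by rewrite cons_rV_lift !mxE liftK /= jk (inj_eq lift_inj).
  by rewrite cons_rV0 !mxE unlift_none /= jk mulr0 addr0.
apply: countable_lebesgue_measure0.
have := cA (cons_rV (0, w)); apply: sub_countable; apply: subset_card_le => t /=.
congr (A _); apply/rowP => i; case: (unliftP ord0 i) => [i' ->|->].
  by rewrite cons_rV_lift !mxE liftK /= j0 mulr0 addr0.
by rewrite cons_rV0 !mxE unlift_none /= j0 !eqxx mulr1 add0r.
Qed.

(** * Limits of a strictly convex function *)

Section strictly_convex.
Context {R : realType} (f : R -> R).
Hypotheses (hf : strictly_convex_pos f) (hf1 : f 1 = 0).

(* As f 1 = 0, this is the slope of the chord of f between 1 and t. *)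
Let S t := f t / (t - 1).

Let slope_lt1 s t : 0 < s -> s < t -> t < 1 -> S s <= S t.
Proof.
move=> s0 st t1; rewrite /S.
have D : 0 < 1 - s by rewrite subr_gt0 (lt_trans st).
have s1 : s != 1 by rewrite lt_eqF// (lt_trans st).
(* The weight of [s] when [t] is written as a convex combination of [s] and 1. *)
have l01 : 0 < (1 - t) / (1 - s) < 1.
  by rewrite divr_gt0 ?D ?subr_gt0//= ltr_pdivrMr// mul1r ltrD2l ltrN2.
have := hf s0 ltr01 s1 l01; rewrite hf1 mulr0 addr0.
have -> : (1 - t) / (1 - s) * s + (1 - (1 - t) / (1 - s)) * 1 = t.
  by field; rewrite gt_eqF.
rewrite mulrAC ltr_pdivlMr// => H.
rewrite -(opprB 1 s) -(opprB 1 t) !invrN !mulrN lerN2.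
rewrite ler_pdivrMr ?subr_gt0// mulrAC ler_pdivlMr//.
by rewrite [f s * _]mulrC ltW.
Qed.

Let slope_gt1 s t : 1 < s -> s < t -> S s <= S t.
Proof.
move=> s1 st; rewrite /S.
have t1 := lt_trans s1 st.
have D : 0 < t - 1 by rewrite subr_gt0.
have t1' : t != 1 by rewrite gt_eqF.
(* Now [s] is the intermediate point, between 1 and [t]. *)
have l01 : 0 < (s - 1) / (t - 1) < 1.
  by rewrite divr_gt0 ?D ?subr_gt0//= ltr_pdivrMr// mul1r ltrD2r.
have := hf (lt_trans ltr01 t1) ltr01 t1' l01; rewrite hf1 mulr0 addr0.
have -> : (s - 1) / (t - 1) * t + (1 - (s - 1) / (t - 1)) * 1 = s.
  by field; rewrite gt_eqF.
rewrite mulrAC ltr_pdivlMr// => H.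
by rewrite ler_pdivrMr ?subr_gt0// mulrAC ler_pdivlMr// [f t * _]mulrC ltW.
Qed.

(** The monotone slope tends at 0 to its infimum, which is at most [S 2^-1], that is
    [- (2 * f 2^-1)]; the factor [t - 1] reverses the sign. *)
Lemma f_at0_ge : ((2 * f 2^-1)%:E <= f_at0 f)%E.
Proof.
have cS : (S t)%:E @[t --> 0^'+] -->
    ereal_inf [set (S t)%:E | t in [set` `]0, 1[ ]].
  apply: (@nondecreasing_at_right_cvge _ (EFin \o S) 0 (BLeft 1)).
    by rewrite bnd_simp.
  move=> s t; rewrite !in_itv/= => /andP[s0 _] /andP[_ t1].
  rewrite lee_fin le_eqVlt => /predU1P[->//|st].
  exact: slope_lt1.
set l := ereal_inf _ in cS.
have l_le : (l <= (- (2 * f 2^-1))%:E)%E.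
  apply: ereal_inf_lbound; exists 2^-1.
    by rewrite /= in_itv/=; apply/andP; split; lra.
  by rewrite /S; congr EFin; field.
have c1 : (t - 1)%:E @[t --> (0:R)^'+] --> (-1)%:E.
  apply: cvg_EFin; first exact: nearW.
  rewrite -[X in _ --> X](add0r (-1)); apply: cvgB; last exact: cvg_cst.
  by apply: cvg_within_filter; exact: cvg_id.
(* Since [f t = S t * (t - 1)] and the second factor tends to -1 rather than 0, the product of
   limits is defined even for infinite [l]. *)
have cf : (f t)%:E @[t --> 0^'+] --> (l * (-1)%:E)%E.
  apply: cvg_trans (cvgeM _ cS c1); last first.
    by case: (l) => [?| |] //; rewrite /mule_def lt_eqF.
  apply: near_eq_cvg; near=> t.
  have t1 : t < 1 by near: t; exact: nbhs_right_lt.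
  by rewrite /= -EFinM /S; congr EFin; rewrite divfK// subr_eq0 lt_eqF.
rewrite /f_at0 (cvg_lim _ cf)// EFinN muleN1.
by rewrite leeNr -EFinN.
Unshelve. all: by end_near. Qed.

Lemma fstar_at0_ge : ((f 2)%:E <= fstar_at0 f)%E.
Proof.
(* Freezing the slope below 2 makes it nondecreasing on the whole line and leaves its limit at
   infinity unchanged; its value at 2 is [f 2]. *)
pose h t : \bar R := (S (Num.max 2 t))%:E.
have cS : h t @[t --> +oo] --> ereal_sup (range h).
  apply: nondecreasing_cvge => s t st; rewrite lee_fin.
  have : Num.max 2 s <= Num.max 2 t by rewrite le_max2 //.
  rewrite le_eqVlt => /predU1P[->//|]; apply: slope_gt1.
  by rewrite lt_max ltr1n.
set l := ereal_sup _ in cS.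
have l_ge : ((f 2)%:E <= l)%E.
  apply: ereal_sup_ubound; exists 2 => //.
  by rewrite /h /S maxxx; congr EFin; field.
(* This factor converts slopes: [f t / t = S t * (1 - t^-1)]. *)
have c1 : (1 - t^-1)%:E @[t --> (+oo : set_system R)] --> 1%:E.
  apply: cvg_EFin; first exact: nearW.
  rewrite -[X in _ --> X](subr0 1); apply: cvgB; first exact: cvg_cst.
  apply/gtr0_cvgV0; last exact: cvg_id.
  exact: nbhs_pinfty_gt.
have cf : (f t / t)%:E @[t --> +oo] --> (l * 1%:E)%E.
  apply: cvg_trans (cvgeM _ cS c1); last first.
    by case: (l) => [?| |] //; rewrite /mule_def gt_eqF.
  apply: near_eq_cvg; near=> t.
  have t2 : 2 <= t by near: t; exact: nbhs_pinfty_ge.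
  rewrite /= -EFinM /S max_r//; congr EFin; field.
  by apply/andP; split; apply/eqP; lra.
by rewrite /fstar_at0 (cvg_lim _ cf)// mule1.
Unshelve. all: by end_near. Qed.

(** The point 1 is the combination of [2^-1] and 2 with weights 2/3 and 1/3. Strict convexity there,
    multiplied by 3, says that the two lower bounds have a positive sum. *)
Lemma f_at0_fstar_at0_gt0 : (0 < f_at0 f + fstar_at0 f)%E.
Proof.
apply: lt_le_trans (leeD f_at0_ge fstar_at0_ge).
rewrite -EFinD lte_fin.
have p0 : 0 < (2^-1 : R) by lra.
have n1 : (2^-1 : R) != 2 by apply/eqP; lra.
have l01 : 0 < (2 / 3 : R) < 1 by apply/andP; split; lra.
have := hf p0 (ltr0n R 2) n1 l01.
have -> : 2 / 3 * 2^-1 + (1 - 2 / 3) * 2 = 1 :> R by field.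
rewrite hf1; lra.
Qed.
End strictly_convex.

(** * The f-divergence of mutually singular measures *)

Section integral_null_sets.
Local Open Scope ereal_scope.
Context d (T : measurableType d) (R : realType) (mu : {measure set T -> \bar R}).
Implicit Types (f g : T -> \bar R) (D N : set T).
Import HBNNSimple.

(* Any simple function below f is a.e. equal to its restriction to ~` N, which is
   below g. Neither f nor g is assumed measurable because the integrand of fdiv
   need not be: f is arbitrary on negative numbers and the Radon-Nikodym
   derivatives are nonnegative only almost everywhere. *)
Let ge0_le_integral_null N f g : measurable N -> mu N = 0 ->
  (forall x, 0 <= f x) -> (forall x, 0 <= g x) ->
  (forall x, ~ N x -> f x = g x) ->
  \int[mu]_x f x <= \int[mu]_x g x.
Proof.
move=> mN N0 f0 g0 fg; rewrite !ge0_integralTE//.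
apply: ge_ereal_sup => _ [h /= hf <-].
have mNC := measurableC mN.
apply: ereal_sup_ubound; exists (proj_nnsfun h mNC) => [x /=|].
  rewrite mindicE; case: (boolP (x \in _)) => xN; last by rewrite mulr0.
  by rewrite mulr1 -fg//; exact: set_mem.
rewrite -!integralT_nnsfun; apply: ae_eq_integral => //.
- exact/measurable_EFinP.
- exact/measurable_EFinP.
exists N; split=> // x /= H; apply: contrapT => xN; apply: H => _ /=.
by rewrite mindicE mem_set// mulr1.
Qed.

Lemma eq_integral_null N D f g : measurable N -> mu N = 0 ->
  (forall x, D x -> ~ N x -> f x = g x) ->
  \int[mu]_(x in D) f x = \int[mu]_(x in D) g x.
Proof.
move=> mN N0 fg; rewrite [LHS]integralE [RHS]integralE.
(* [h] stands for the positive part and for the negative part. *)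
suff H (h : \bar R -> \bar R) : (forall y, 0 <= h y) ->
    \int[mu]_(x in D) h (f x) = \int[mu]_(x in D) h (g x).
  rewrite funepos.unlock funeneg.unlock; congr (_ - _).
    by apply: (H (fun y => maxe y 0)) => y; rewrite le_max lexx orbT.
  by apply: (H (fun y => maxe (- y) 0)) => y; rewrite le_max lexx orbT.
move=> h0; rewrite [LHS]integral_mkcond [RHS]integral_mkcond.
have r0 k x : 0 <= ((fun x => h (k x)) \_ D) x by rewrite patchE; case: ifP.
have E x : ~ N x -> ((fun x => h (f x)) \_ D) x = ((fun x => h (g x)) \_ D) x.
  by move=> xN; rewrite !patchE; case: ifP => // /set_mem Dx; rewrite fg.
by apply/eqP; rewrite eq_le; apply/andP; split;
  apply: (ge0_le_integral_null mN N0) => // x /E.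
Qed.

Lemma integral_null D f : measurable D -> mu D = 0 -> \int[mu]_(x in D) f x = 0.
Proof.
move=> mD D0; rewrite (@eq_integral_null D D f (cst 0))// ?integral0//.
Qed.
End integral_null_sets.

Section singular_fdiv.
Context d (T : measurableType d) (R : realType).
Implicit Types (mu gamma : probability T R) (f : R -> R).
Local Open Scope charge_scope.
Local Open Scope ereal_scope.

(** Inside [B] the measure [tau] is half of [mu], and [mu] does not charge the complement. Only the
    formula for [tau] is assumed, so the lemma also serves with [mu] and [gamma] exchanged. *)
Lemma Radon_Nikodym_two_indic (tau mu gamma : probability T R) (B : set T) :
  measurable B -> mu (~` B) = 0 -> gamma B = 0 ->
  (forall E, measurable E -> tau E = (2^-1)%:E * (mu E + gamma E)) ->
  exists N, [/\ measurable N, tau N = 0 &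
    forall x, ~ N x ->
      ('d (charge_of_finite_measure mu) '/d tau) x = (2 * \1_B x)%:E].
Proof.
move=> mB muB gammaB tauE.
have dom : charge_of_finite_measure mu `<< tau.
  apply/null_content_dominatesP => E mE tE0; have := tauE E mE.
  rewrite [LHS]tE0 => /esym/eqP.
  rewrite mule_eq0 eqe invr_eq0 pnatr_eq0/= padde_eq0 ?measure_ge0//.
  by case/andP => /eqP.
have mg : measurable_fun [set: T] (fun x => (2 * \1_B x)%:E : \bar R).
  apply/measurable_EFinP; apply: measurable_funM => //.
have [|N [mN N0 NE]] := @integral_ae_eq _ _ _ tau setT measurableT
  (fun x => (2 * \1_B x)%:E) ('d (charge_of_finite_measure mu) '/d tau)
  (Radon_Nikodym_integrable dom) mg.
  move=> E _ mE; rewrite -Radon_Nikodym_integral//.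
  under eq_integral do rewrite EFinM.
  rewrite ge0_integralZl//; last exact/measurable_EFinP/measurable_indic.
  rewrite integral_indic//.
  have mBE : measurable (B `&` E) by exact: measurableI.
  rewrite [X in _ * X](tauE _ mBE) (_ : gamma _ = 0); last first.
    by apply: subset_measure0 gammaB => //; exact: subIsetl.
  rewrite adde0 muleA -EFinM mulfV ?pnatr_eq0// mul1e.
  have mCE : measurable (~` B `&` E) by apply: measurableI => //; exact: measurableC.
  have muBE : mu (~` B `&` E) = 0.
    by apply: subset_measure0 muB => //; exact: measurableC.
  transitivity (mu (B `&` E `|` ~` B `&` E)); last exact: measureU0.
  by rewrite -setIUl setUv setTI.
exists N; split=> // x xN; apply: contrapT => H; apply: xN; apply: NE => /=.
exact/not_implyP.
Qed.

Lemma fdiv_singular f mu gamma : -oo < f_at0 f -> -oo < fstar_at0 f ->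
  mutually_singular mu gamma -> fdiv f mu gamma = f_at0 f + fstar_at0 f.
Proof.
move=> f0 fs0 [A [mA muA gammaA]]; rewrite /fdiv.
have mAC := measurableC mA.
pose tau : probability T R := midpoint mu gamma.
have tauE E : measurable E -> tau E = (2^-1)%:E * (mu E + gamma E).
  by move=> _; exact: midpointE.
have tauE' E : measurable E -> tau E = (2^-1)%:E * (gamma E + mu E).
  by move=> mE; rewrite addeC tauE.
have muAC : mu (~` ~` A) = 0 by rewrite setCK.
have [N [mN N0 pE]] := Radon_Nikodym_two_indic mAC muAC gammaA tauE.
have [M [mM M0 qE]] := Radon_Nikodym_two_indic mA gammaA muA tauE'.
(* Almost everywhere, p = 0 and q = 2 on [A], while p = 2 and q = 0 off [A]. Both sets have
   [tau]-mass 1/2, which cancels the factor 2. *)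
pose G x : \bar R := (if x \in A then 2%:E * f_at0 f else 2%:E * fstar_at0 f).
rewrite (@eq_integral_null _ _ _ tau (N `|` M) setT _ G)//.
- rewrite -(setUv A) integral_setU//; last 2 first.
  + apply: measurable_funTS; apply: measurable_fun_ifT => //.
    apply: (measurable_fun_bool true); rewrite setTI.
    rewrite [X in measurable X](_ : _ = A)//.
    by apply/seteqP; split=> x; [exact: set_mem|exact: mem_set].
  + exact/disj_setPCl.
  rewrite (@eq_integral _ _ _ _ _ (cst (2%:E * f_at0 f)))//; last first.
    by move=> x xA; rewrite /G xA.
  rewrite [X in _ + X](@eq_integral _ _ _ _ _ (cst (2%:E * fstar_at0 f)))//; last first.
    by move=> x; rewrite inE /= => xA; rewrite /G memNset.
  have gammaA1 : gamma A = 1.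
    by rewrite -(setCK A) probability_setC// gammaA sube0.
  have muA1 : mu (~` A) = 1 by rewrite probability_setC// muA sube0.
  rewrite !integral_cst//= !midpointE muA gammaA gammaA1 muA1 add0e adde0 mule1.
  have half (y : \bar R) : 2%:E * y * (2^-1)%:E = y.
    by rewrite muleAC -EFinM mulfV ?pnatr_eq0// mul1e.
  by rewrite !half.
- exact: measurableU.
- apply/eqP; rewrite -measure_le0 -[leRHS](adde0 0).
  by rewrite -[X in _ <= X + _]N0 -[X in _ <= _ + X]M0 measureU2.
move=> x _ NM; rewrite pE ?qE; [|by move=> ?; apply: NM; right|by move=> ?; apply: NM; left].
rewrite /fdiv_integrand /G /= !indicE in_setC; case: (x \in A) => /=.
  by rewrite !mulr0 !mulr1 pnatr_eq0/= eqxx muleC.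
by rewrite !mulr0 !mulr1 eqxx muleC.
Qed.
End singular_fdiv.

(** * Level sets of immersions *)

Lemma continuous_mulmx_coord (R : realType) n p (C : 'M[R]_(n, p)) k :
  continuous (fun w : 'rV[R]_n => (w *m C) ord0 k).
Proof.
have -> : (fun w : 'rV[R]_n => (w *m C) ord0 k) =
    (fun w => \sum_i w ord0 i * C i k) by apply/funext => ?; rewrite mxE.
apply: continuous_big => [x|i _ w]; first exact: add_continuous.
exact: (@cvgMr_tmp _ _ (nbhs w) _ _ _ _ (@coord_continuous R 1 n ord0 i w)).
Qed.

(** An interval with rational end points that meets [S] only in [x] determines [x], and there are
    countably many such intervals. *)
Lemma countable_isolated (R : realType) (S : set R) :
  (forall x, S x -> exists2 e, 0 < e &
     forall y, S y -> `|y - x| < e -> y = x) ->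
  countable S.
Proof.
move=> iso.
have /choice[q qP] x : exists q : rat * rat, S x ->
    ratr q.1 < x < ratr q.2 /\ forall y, S y -> ratr q.1 < y < ratr q.2 -> y = x.
  have [Sx|nSx] := pselect (S x); last by exists (0, 0).
  have [e e0 eS] := iso x Sx.
  have /rat_in_itvoo[a] : x - e < x by rewrite ltrBlDr ltrDl.
  have /rat_in_itvoo[b] : x < x + e by rewrite ltrDl.
  rewrite !in_itv/= => /andP[xb be] /andP[ea ax].
  exists (a, b) => _; split=> [|y Sy /andP[ay yb]]; first by rewrite /= ax.
  by apply: eS => //; rewrite ltr_distl (lt_trans ea ay) (lt_trans yb be).
apply/countable_injP; exists (fun x => pickle (q x)) => x y /set_mem Sx /set_mem Sy.
move=> /(pcan_inj pickleK) qxy.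
have [qx _] := qP x Sx; have [_ qyS] := qP y Sy.
by apply: qyS => //; rewrite -qxy.
Qed.

Section regular_points.
Context {R : realType} {n p k : nat}.
Variables (psi : 'rV[R]_n -> 'rV[R]_p) (C : 'M[R]_(p, k)) (b : 'rV[R]_k).

Lemma level_set_isolated u v j : derivable psi u v -> psi u *m C = b ->
  ('D_v psi u *m C) ord0 j != 0 ->
  exists2 e, 0 < e &
    forall t, t != 0 -> `|t| < e -> psi (u + t *: v) *m C <> b.
Proof.
move=> dpsi psib D0; pose ell (w : 'rV[R]_p) : R := (w *m C) ord0 j.
pose q t := t^-1 *: ((psi \o shift u) (t *: v) - psi u).
have cq : ell (q t) @[t --> 0^'] --> ell ('D_v psi u).
  apply: (cvg_comp q ell dpsi); exact: continuous_mulmx_coord.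
have : \forall t \near 0^', ell (q t) != 0 by exact: cvgr_neq0 cq D0.
move=> /nbhs_ballP[e /= e0 eP]; exists e => // t t0 te psit.
have /(_ _ t0)/eqP := eP t.
rewrite /ball/= sub0r normrN => /(_ te); apply.
rewrite /ell /q /= -scalemxAl mulmxBl [t *: v + u]addrC psit psib subrr scaler0.
by rewrite mxE.
Qed.
End regular_points.

(** * Countable unions of null sets and Borel sets of row vectors *)

Lemma negligible_countable_bigcup d (T : measurableType d) (R : realType)
    (mu : {measure set T -> \bar R}) (I : countType) (F : I -> set T) :
  (forall i, mu.-negligible (F i)) -> mu.-negligible (\bigcup_i F i).
Proof.
move=> nF; pose G n := if unpickle n is Some i then F i else set0.
apply: negligibleS (_ : mu.-negligible (\bigcup_n G n)) => [x [i _ Fix]|].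
  by exists (pickle i) => //; rewrite /G pickleK.
apply: negligible_bigcup => n; rewrite /G; case: unpickle => [i|]; first exact: nF.
exact: negligible_set0.
Qed.

Lemma open_measurable_rV (R : realType) n (A : set 'rV[R]_n) :
  open A -> measurable A.
Proof. exact: sub_sigma_algebra. Qed.

Lemma closed_measurable_rV (R : realType) n (A : set 'rV[R]_n) :
  closed A -> measurable A.
Proof.
move=> cA; rewrite -(setCK A); apply: measurableC; apply: open_measurable_rV.
exact: closed_openC.
Qed.

Lemma open_setI_preimage (X Y : topologicalType) (U : set X) (O : set Y)
    (f : X -> Y) : open U -> open O ->
  (forall x, U x -> {for x, continuous f}) -> open (U `&` f @^-1` O).
Proof.
move=> oU oO cf; rewrite openE => x [Ux Ofx].
apply: filterI; first exact: open_nbhs_nbhs.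
by apply: (cf x Ux); exact: open_nbhs_nbhs.
Qed.

Lemma closed_affine (R : realType) n k (C : 'M[R]_(n, k)) (b : 'rV[R]_k) :
  closed [set y : 'rV[R]_n | y *m C = b].
Proof.
have -> : [set y : 'rV[R]_n | y *m C = b] =
    \bigcap_j [set y | (y *m C) ord0 j = b ord0 j].
  apply/seteqP; split=> [y yb j _ /=|y /= yb].
    by rewrite [y *m C]yb.
  by apply/rowP => j; exact: (yb j I).
apply: closed_bigI => j _.
apply: (@preimage_closed _ _ (fun w : 'rV[R]_n => (w *m C) ord0 j) [set b ord0 j]).
  by move=> w _; exact: continuous_mulmx_coord.
exact: closed_eq.
Qed.

(** * Preimages of affine subspaces under charts *)

Section immersions.
Context {R : realType} {n p k : nat}.
Variables (U : set 'rV[R]_n) (psi : 'rV[R]_n -> 'rV[R]_p).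
Variables (C : 'M[R]_(p, k)) (b : 'rV[R]_k).
Hypotheses (oU : open U) (psi1 : Ck_on 1 U psi).

Let S := U `&` [set u | psi u *m C = b].

Lemma measurable_affine_preimage : measurable S.
Proof.
(* Continuity of [psi] is known only on [U], so [S] is written as a difference of two open sets. *)
have -> : S = U `\` (U `&` psi @^-1` (~` [set y | y *m C = b])).
  apply/seteqP; split=> [u [Uu ub]|u [Uu ub]]; first by split=> // -[_ /=].
  by split=> //; apply: contrapT => nb; apply: ub.
apply: measurableD; apply: open_measurable_rV => //.
apply: open_setI_preimage => //; first exact/closed_openC/closed_affine.
by move=> u Uu; apply: differentiable_continuous; case: psi1 => + _; exact.
Qed.

Hypothesis (transverse : forall u, U u -> 'J psi u *m C <> 0).

Lemma affine_preimage_null : lebesgue_rV n S = 0%E.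
Proof.
have mS := measurable_affine_preimage.
case: psi1 => dpsi cpsi.
pose e i : 'rV[R]_n := delta_mx ord0 i.
pose Z (q : 'I_n * 'I_k) :=
  S `&` [set u | ('D_(e q.1) psi u *m C) ord0 q.2 != 0].
apply: measure_negligible => //.
apply: negligibleS (_ : (lebesgue_rV n).-negligible (\bigcup_q Z q)) => [u Su|].
  have [Uu _] := Su.
  have [i [j ij]] : exists i j, ('J psi u *m C) i j != 0.
    apply: contrapT => H; apply: (transverse Uu); apply/matrixP => i j.
    by rewrite [RHS]mxE; apply/eqP; apply: contrapT => /negP ij; apply: H; exists i, j.
  exists (i, j) => //; split=> //=.
  by rewrite deriveEjacobian; [rewrite -mulmxA -rowE mxE|exact: dpsi].
apply: negligible_countable_bigcup => -[i j].
have mZ : measurable (Z (i, j)).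
  (* By continuity of the partial derivative on [U], its nonvanishing is an open condition. *)
  have -> : Z (i, j) = S `&` (U `&` (fun u => ('D_(e i) psi u *m C) ord0 j) @^-1`
      [set x | x != 0]).
    by apply/seteqP; split=> u; rewrite /Z /S /=; [move=> [[]]|move=> [? []]].
  apply: measurableI => //; apply: open_measurable_rV; apply: open_setI_preimage => //.
  move=> u Uu; exact: (@continuous_comp _ _ _ ('D_(e i) psi) (fun w : 'rV[R]_p => (w *m C) ord0 j)
    u (cpsi (e i) u Uu) 
    (@continuous_mulmx_coord _ _ _ C j _)).
apply/negligibleP => //.
apply: (lebesgue_rV_countable_lines mZ (j := i)) => v.
apply: countable_isolated => x [[Ux psix] /= Dx].
have [d d0 dP] := level_set_isolated (@diff_derivable _ _ _ _ _ (e i) (dpsi _ Ux)) psix Dx.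
exists d => // y [[_ psiy] _] xy; apply/eqP; rewrite -subr_eq0; apply: contrapT.
move=> /negP yx0; apply: (dP _ yx0 xy); rewrite -[RHS]psiy.
by rewrite -addrA -scalerDl [x + _]addrC subrK.
Qed.
End immersions.

(** * Ranges of ReLU networks *)

(** On a vector, [relu] acts as a diagonal 0-1 matrix given by its sign pattern. Each layer has
    finitely many patterns, so composing multiplies finite index types. *)
Lemma relu_map_piecewise_affine (R : realType) m n
    (phi : 'rV[R]_m -> 'rV[R]_n) : relu_map phi ->
  exists (I : finType) (A : I -> 'M[R]_(m, n)) (b : I -> 'rV[R]_n),
    forall x, exists i, phi x = affine_map (A i) (b i) x.
Proof.
pose D k (s : {ffun 'I_k -> bool}) : 'M[R]_k := diag_mx (\row_j (s j)%:R).
have reluE k (x : 'rV[R]_k) : exists s, relu x = x *m D k s.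
  exists [ffun j => 0 <= x ord0 j]; apply/rowP => j; rewrite mul_mx_diag !mxE ffunE.
  by case: leP => x0; rewrite ?mulr1 ?mulr0.
have step k l (A : 'M[R]_(k, l)) b (psi : 'rV[R]_m -> 'rV[R]_k) (I : finType)
    (A' : I -> 'M[R]_(m, k)) (b' : I -> 'rV[R]_k) :
    (forall x, exists i, psi x = affine_map (A' i) (b' i) x) ->
  exists (I : finType) (A'' : I -> 'M[R]_(m, l)) (b'' : I -> 'rV[R]_l),
    forall x, exists i, (affine_map A b \o @relu R k \o psi) x =
      affine_map (A'' i) (b'' i) x.
  move=> psiE; exists (I * {ffun 'I_k -> bool})%type.
  exists (fun i => A' i.1 *m D k i.2 *m A), (fun i => b' i.1 *m D k i.2 *m A + b).
  move=> x; have [i psix] := psiE x; have [s rs] := reluE k (psi x).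
  exists (i, s); rewrite /= rs psix /affine_map /=.
  by rewrite !mulmxDl !mulmxA addrA.
elim=> [k l A0 b0 A1 b1|k l A b psi _ [I [A' [b' psiE]]]]; last exact: step psiE.
apply: (step _ _ _ _ _ unit (fun=> A0) (fun=> b0)) => x.
by exists tt.
Qed.

Section low_dimensional_range.
Context {R : realType} {d m : nat}.

(* The affine subspace b + rowspace A. *)
Let affine_range (A : 'M[R]_(m, d)) (b : 'rV[R]_d) :=
  [set y : 'rV[R]_d | y *m cokermx A = b *m cokermx A].

Lemma relu_singular (mu : probability 'rV[R]_d R) (nu : probability 'rV[R]_m R)
    (phi : relu_network R m d) :
  (forall A b, mu (affine_range A b) = 0%E) ->
  mutually_singular mu (distribution nu phi).
Proof.
move=> mu0; have [I [A [b phiE]]] := relu_map_piecewise_affine (relu_funP phi).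
(* This union contains the range of [phi], so its complement has empty preimage. *)
exists (\bigcup_i affine_range (A i) (b i)).
have mB i : measurable (affine_range (A i) (b i)).
  by apply: closed_measurable_rV; exact: closed_affine.
have mU : measurable (\bigcup_i affine_range (A i) (b i)).
  by apply: countable_bigcupT_measurable => //; exact: countableP.
split=> //.
  apply: measure_negligible => //; apply: negligible_countable_bigcup => i.
  by apply/negligibleP; [exact: mB|exact: mu0].
transitivity (nu set0); last exact: measure0.
rewrite /distribution /pushforward /=; congr (nu _).
apply/seteqP; split=> // x /=; apply; have [i ->] := phiE x.
by exists i => //; rewrite /affine_range /= mulmxDl -mulmxA mulmx_coker mulmx0 add0r.
Qed.

(** Transversality is a rank count: if the Jacobian were killed by [cokermx A], its row space, of
    dimension [s], would lie in that of [A], of dimension at most [m]. *)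
Lemma chart_affine_range_null s (U : set 'rV[R]_s) (psi : 'rV[R]_s -> 'rV[R]_d) A b :
  (m < s)%N -> open U -> Ck_on 1 U psi -> (forall u, U u -> row_free ('J psi u)) ->
  measurable (U `&` psi @^-1` affine_range A b) /\
  lebesgue_rV s (U `&` psi @^-1` affine_range A b) = 0%E.
Proof.
move=> ms oU psi1 rf; split; first exact: measurable_affine_preimage.
apply: affine_preimage_null => // u Uu /eqP; rewrite -submxE => /mxrankS.
by rewrite (eqP (rf u Uu)) leqNgt (leq_ltn_trans (rank_leq_row A) ms).
Qed.

(** The whole space is treated as parametrized by the identity chart. *)
Lemma lebesgue_affine_range_null A b : (m < d)%N ->
  lebesgue_rV d (affine_range A b) = 0%E.
Proof.
move=> md; have Did (v x : 'rV[R]_d) : 'D_v id x = v by rewrite derive_id.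
have Ck_id : Ck_on 1 [set: 'rV[R]_d] id.
  split=> [x _|v x _] /=; first exact: ex_diff.
  have -> : 'D_v id = cst v by apply/funext => y; exact: Did.
  exact: cst_continuous.
have J1 u : 'J id u = 1%:M :> 'M[R]_d.
  apply/row_matrixP => i; rewrite rowE -deriveEjacobian; last exact: ex_diff.
  by rewrite Did row1.
have rf (u : 'rV[R]_d) : [set: 'rV[R]_d] u -> row_free ('J id u).
  by move=> _; rewrite J1 row_free_unit unitmx1.
by have [_] := chart_affine_range_null A b md openT Ck_id rf; rewrite setTI.
Qed.
End low_dimensional_range.

(** * Submanifolds *)

(** Boxes with rational centres form a countable base; [G i] is a chosen open set with [P] around
    box [i], or empty if there is none. *)
Lemma lindelof_rV (R : realType) n (P : set 'rV[R]_n -> Prop) (M : set 'rV[R]_n) :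
  (forall x, M x -> exists V, [/\ open V, V x & P V]) ->
  exists G : 'rV[rat]_n * nat -> set 'rV[R]_n,
    (forall i, G i = set0 \/ open (G i) /\ P (G i)) /\ M `<=` \bigcup_i G i.
Proof.
move=> MP.
pose box (i : 'rV[rat]_n * nat) : set 'rV[R]_n :=
  [set v | forall j, `|ratr (i.1 ord0 j) - v ord0 j| < i.2.+1%:R^-1].
have /choice[G GP] : forall i, exists g : set 'rV[R]_n, (g = set0 \/ open g /\ P g) /\
    forall O, open O -> P O -> box i `<=` O -> box i `<=` g.
  move=> i; have [[V [oV PV bV]]|nV] := pselect (exists V, [/\ open V, P V & box i `<=` V]).
    by exists V; split=> //; right.
  exists set0; split; first by left.
  by move=> V oV PV bV; exfalso; apply: nV; exists V.
exists G; split=> [i|x Mx]; first by have [] := GP i.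
have [V [oV Vx PV]] := MP x Mx.
have /nbhs_ballP[e /= e0 eV] : nbhs x V by exact: open_nbhs_nbhs.
have e2 : 0 < e / 2 by rewrite divr_gt0.
have [k _ /(_ k (leqnn k)) ke] := near_infty_natSinv_lt (PosNum e2).
have /choice[q qP] j : exists q : rat, `|ratr q - x ord0 j| < k.+1%:R^-1.
  have k0 : 0 < k.+1%:R^-1 :> R by rewrite invr_gt0.
  have /rat_in_itvoo[q] : x ord0 j - k.+1%:R^-1 < x ord0 j + k.+1%:R^-1.
    by rewrite ltrBlDr -addrA ltrDl addr_gt0.
  by rewrite in_itv/= => qx; exists q; rewrite ltr_distl.
pose i := (\row_j q j, k); have [_ GiP] := GP i; exists i => //.
apply: (GiP V) => // [v bv|j /=]; last by rewrite mxE.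
apply: eV; split=> // i' j; rewrite ord1 /ball/=.
rewrite (splitr e) (le_lt_trans (ler_distD (ratr (q j)) _ _))//.
have := bv j; rewrite mxE/= => bvj.
by rewrite ltrD// ?(lt_trans _ ke)// distrC.
Qed.

Section submanifolds.
Context {R : realType} {d : nat}.
Implicit Types (M : set 'rV[R]_d).

(* Near each of its points, M agrees with the image of a compact set, hence M is
   locally closed. *)
Lemma submanifold_locally_measurable s M x : @embedded_submanifold R d s M -> M x ->
  exists V, [/\ open V, V x & measurable (M `&` V) /\
    exists U psi, @local_parametrization R d s M U psi /\ M `&` V `<=` psi @` U].
Proof.
move=> hM Mx; have [U [psi [chart [u Uu psiu]]]] := hM x Mx.
have [oU smooth_psi _ _ open_psi] := chart.
have /nbhs_ballP[e /= e0 eU] : nbhs u U by exact: open_nbhs_nbhs.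
(* Half the radius keeps the closed cube inside the ball on which [U] is known. *)
pose I (i : 'I_s) : set R := `[u ord0 i - e / 2, u ord0 i + e / 2]%classic.
pose K : set 'rV[R]_s := [set v | forall i, I i (v ord0 i)].
have cK : compact K by apply: rV_compact => i; exact: segment_compact.
have e2 : 0 < e / 2 by rewrite divr_gt0.
have KU : K `<=` U.
  move=> v Kv; apply: eU; split=> // i j; rewrite ord1 /ball/=.
  have := Kv j; rewrite /I /= in_itv/= -ler_distlC => /le_lt_trans; apply.
  by rewrite ltr_pdivrMr// ltr_pMr// ltr1n.
have uK : K^° u.
  apply/nbhs_ballP; exists (e / 2) => //= v [_ uv] i.
  by rewrite /I /= in_itv/= -ler_distlC; have := uv ord0 i; rewrite /ball/= => /ltW.
have [V oV psiV] := open_psi _ (@open_interior _ K) (subset_trans (@interior_subset _ K) KU).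
have psiVK : M `&` V `<=` psi @` K.
  by rewrite -psiV; apply: image_subset; exact: interior_subset.
exists V; split=> //.
  suff : (M `&` V) x by case.
  by rewrite -psiV; exists u.
split; last by exists U, psi; split=> //; apply: subset_trans psiVK _; exact: image_subset.
(* The image of [K] is compact, hence closed, so the right-hand side is Borel. *)
have -> : M `&` V = psi @` K `&` V.
  apply/seteqP; split=> [y [My Vy]|y [Ky Vy]]; first by split=> //; exact: psiVK.
  split=> //; have [W oW psiW] := open_psi U oU (@subset_refl _ U).
  suff : (M `&` W) y by case.
  by rewrite -psiW; apply: image_subset Ky.
apply: measurableI; last exact: open_measurable_rV.
apply: closed_measurable_rV; apply: compact_closed; first exact: norm_hausdorff.
apply: continuous_compact => //; apply: continuous_in_subspaceT => v /set_mem Kv.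
by apply: (smooth_psi 0%N); exact: KU.
Qed.

(** Countably many charts cover [M], and in each one the volume of [B] is an integral over a
    Lebesgue-null set. *)
Lemma riemannian_measure_null s M g (vol : {measure set 'rV[R]_d -> \bar R}) B :
  @embedded_submanifold R d s M -> @riemannian_measure R d s M g vol ->
  measurable B ->
  (forall U psi, @local_parametrization R d s M U psi ->
     measurable (U `&` psi @^-1` B) /\ lebesgue_rV s (U `&` psi @^-1` B) = 0%E) ->
  vol B = 0%E.
Proof.
move=> hM [volM volE] mB B0.
have [G [GP MG]] := lindelof_rV (fun x => submanifold_locally_measurable hM).
have MGE : M = \bigcup_i (M `&` G i).
  apply/seteqP; split=> [x Mx|x [i _ []]//].
  by have [i _ Gi] := MG x Mx; exists i.
have mMG i : measurable (M `&` G i).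
  by case: (GP i) => [->|[_ [//]]]; rewrite setI0.
(* With [M] Borel, its complement is a negligible set for [vol]. *)
have mM : measurable M.
  by rewrite MGE; apply: countable_bigcupT_measurable => //; exact: countableP.
apply: measure_negligible => //.
apply: negligibleS (_ : vol.-negligible (~` M `|` \bigcup_i (B `&` (M `&` G i)))).
  move=> x Bx; have [Mx|nMx] := pselect (M x); last by left.
  by right; have [i _ Gi] := MG x Mx; exists i.
apply: negligibleU; first by apply/negligibleP => //; exact: measurableC.
apply: negligible_countable_bigcup => i.
case: (GP i) => [->|[_ [_ [U [psi [chart GU]]]]]].
  by rewrite !setI0; exact: negligible_set0.
apply: negligibleS (_ : vol.-negligible (B `&` psi @` U)).
  by move=> x [Bx /GU].
have [oU _ _ _ open_psi] := chart.
have [W oW psiW] := open_psi U oU (@subset_refl _ U).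
have mBU : measurable (B `&` psi @` U).
  rewrite psiW; apply: measurableI => //; apply: measurableI => //.
  exact: open_measurable_rV.
apply/negligibleP => //; rewrite [LHS](volE _ _ chart _ mB).
by have [? ?] := B0 _ _ chart; exact: integral_null.
Qed.
End submanifolds.

(** * Singularity, value of the divergence and necessity of [s <= m] *)

Theorem mainTheorem4 (R : realType) (f : R -> R)
    (hf : strictly_convex_pos f) (hf1 : f 1 = 0)
    (d m : nat) (mu : probability 'rV[R]_d R) :
  (* (a) *)
  (forall (nu : probability 'rV[R]_m R) (phi : relu_network R m d),
    (m < d)%N -> mu `<< lebesgue_rV d ->
    mutually_singular mu (distribution nu phi) /\
    fdiv f mu (distribution nu phi) = (f_at0 f + fstar_at0 f)%E /\
    (0 < f_at0 f + fstar_at0 f)%E) /\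
  (* (b) *)
  (forall (s : nat) (M : set 'rV[R]_d) (g : 'rV[R]_d -> 'M[R]_d)
      (vol : {measure set 'rV[R]_d -> \bar R}),
    (s <= d)%N -> embedded_submanifold s M -> riemannian_metric s M g ->
    riemannian_measure s M g vol -> mu `<< vol ->
    (forall (nu : probability 'rV[R]_m R) (phi : relu_network R m d),
      (m < s)%N ->
      mutually_singular mu (distribution nu phi) /\
      fdiv f mu (distribution nu phi) = (f_at0 f + fstar_at0 f)%E /\
      (0 < f_at0 f + fstar_at0 f)%E) /\
    ((forall eps : R, 0 < eps ->
        exists (nu : probability 'rV[R]_m R) (phi : relu_network R m d),
          (fdiv f mu (distribution nu phi) < eps%:E)%E) ->
      (s <= m)%N)).
Proof.
have c_gt0 := f_at0_fstar_at0_gt0 hf hf1.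
have singularE (nu : probability 'rV[R]_m R) (phi : relu_network R m d) :
    mutually_singular mu (distribution nu phi) ->
    mutually_singular mu (distribution nu phi) /\
    fdiv f mu (distribution nu phi) = (f_at0 f + fstar_at0 f)%E /\
    (0 < f_at0 f + fstar_at0 f)%E.
  move=> sing; split=> //; split=> //; apply: fdiv_singular sing.
    by apply: lt_le_trans (f_at0_ge hf hf1); exact: ltNyr.
  by apply: lt_le_trans (fstar_at0_ge hf hf1); exact: ltNyr.
split=> [nu phi md mu_leb|s M g vol _ hM _ hvol mu_vol].
  apply: singularE; apply: relu_singular => A b.
  move/null_content_dominatesP : mu_leb; apply; last exact: lebesgue_affine_range_null.
  by apply: closed_measurable_rV; exact: closed_affine.
have sing (nu : probability 'rV[R]_m R) (phi : relu_network R m d) :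
    (m < s)%N -> mutually_singular mu (distribution nu phi) /\
    fdiv f mu (distribution nu phi) = (f_at0 f + fstar_at0 f)%E /\
    (0 < f_at0 f + fstar_at0 f)%E.
  move=> ms; apply: singularE; apply: relu_singular => A b.
  have mB := closed_measurable_rV (@closed_affine R _ _ (cokermx A) (b *m cokermx A)).
  move/null_content_dominatesP : mu_vol; apply=> //.
  apply: (riemannian_measure_null hM hvol mB) => U psi [oU smooth_psi _ rf _].
  by apply: chart_affine_range_null => //; exact: smooth_psi.
split=> // approx; rewrite leqNgt; apply/negP => ms.
(* For [m < s] every network gives the same positive constant, so an [eps] below it refutes
   approximation; if the constant is [+oo], 1 serves. *)
have [eps eps0 eps_le] : exists2 eps : R, 0 < eps &
    (eps%:E <= f_at0 f + fstar_at0 f)%E.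
  case: (f_at0 f + fstar_at0 f)%E c_gt0 => [c c0|_|//]; last by exists 1 => //; exact: leey.
  by exists c.
have [nu [phi]] := approx eps eps0.
by have [_ [-> _]] := sing nu phi ms; rewrite ltNge eps_le.
Qed.
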